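(* Let $B$ be a skew brace. Then $B$ is annihilator nilpotent if and only if there exists a positive integer $c$ such that $\Gamma_{[c]}(B)=0$.
   Context: A skew brace is a triple $(B,+,\circ)$ where $(B,+)$ and $(B,\circ)$ are (not necessarily abelian) groups such that $a\circ(b+c)=a\circ b-a+a\circ c$ for all $a,b,c\in B$. The two groups share the same identity, denoted $0$. Put $\lambda_a(b)=-a+a\circ b$ and $a*b=-a+a\circ b-b$. An ideal of $B$ is a subset that is a normal subgroup of both $(B,+)$ and $(B,\circ)$ and is mapped into itself by every $\lambda_a$. The annihilator is $\operatorname{Ann}(B)=\{x\in B: x\circ a=a\circ x=x+a=a+x \text{ for all } a\in B\}$, an ideal of $B$. An annihilator series of $B$ is a series of ideals $0=I_0\subseteq I_1\subseteq\cdots\subseteq I_n=B$ with $I_{j+1}/I_j\subseteq\operatorname{Ann}(B/I_j)$ for $0\le j<n$; $B$ is annihilator nilpotent if it has an annihilator series. For subsets $X,Y\subseteq B$, $X*Y$ is the additive subgroup generated by $\{x*y:x\in X,\ y\in Y\}$, and $[X,Y]_+$ is the additive subgroup generated by the commutators $[x,y]_+=x+y-x-y$ with $x\in X$, $y\in Y$. Define $\Gamma_{[1]}(B)=B$ and, for $n\ge 2$, let $\Gamma_{[n]}(B)$ be the additive subgroup generated by all $\Gamma_{[i]}(B)*\Gamma_{[n-i]}(B)$ and $[\Gamma_{[i]}(B),\Gamma_{[n-i]}(B)]_+$ with $1\le i\le n-1$. *)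

(* Defs.v *)
From HB Require Import structures.
From mathcomp Require Import all_boot generic_quotient ssralg.
From mathcomp Require Import zify.
From mathcomp Require Import boolp classical_sets.

Set Implicit Arguments.
Unset Strict Implicit.
Unset Printing Implicit Defensive.

Local Open Scope classical_set_scope.
Local Open Scope ring_scope.

(* The group (B, o) is the [groupType] structure, written [(a * b)%g], [1%g]   *)
(* and [a^-1%g].  For (B, +), [baseAddUMagmaType] only provides the operation  *)
(* [a + b] and the element [0]; it is not assumed commutative (the additive    *)
(* groups of the library are), hence the explicit opposite and group axioms.   *)
(* That [0 = 1%g] is proved in [brace1] rather than required.                  *)
HB.mixin Record isSkewBrace B & Group B & GRing.BaseAddUMagma B := {
  bropp : B -> B;
  braddA : forall a b c : B, a + (b + c) = a + b + c;
  bradd0 : forall a : B, 0 + a = a;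
  braddN : forall a : B, bropp a + a = 0;
  brace_eq : forall a b c : B,
    (a * (b + c))%g = (a * b)%g + bropp a + (a * c)%g
}.

#[short(type="skewBraceType")]
HB.structure Definition SkewBrace :=
  {B of isSkewBrace B & Group B & GRing.BaseAddUMagma B}.

Local Notation "- a" := (bropp a) : ring_scope.
Local Notation "a - b" := (a + bropp b) : ring_scope.

Section Operations.
Variable B : skewBraceType.
Implicit Types (a b x y : B) (X Y I : set B).

Definition lambda a b := - a + (a * b)%g.

Definition star a b := - a + (a * b)%g - b.

Definition addcomm x y := x + y - x - y.

Definition add_subgroup X :=
  [/\ X 0, forall x y, X x -> X y -> X (x + y) & forall x, X x -> X (- x)].

Definition mul_subgroup X :=
  [/\ X 1%g, forall x y, X x -> X y -> X (x * y)%g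
    & forall x, X x -> X (x^-1)%g].

Definition add_normal X :=
  add_subgroup X /\ forall a x, X x -> X (a + x - a).

Definition mul_normal X :=
  mul_subgroup X /\ forall a x, X x -> X (a * x * a^-1)%g.

Definition is_ideal I :=
  [/\ add_normal I, mul_normal I & forall a x, I x -> I (lambda a x)].

Definition add_generated X : set B := smallest add_subgroup X.

Definition star_set X Y : set B :=
  add_generated [set star x y | x in X & y in Y].

Definition addcomm_set X Y : set B :=
  add_generated [set addcomm x y | x in X & y in Y].

Definition Gamma_step (G : nat -> set B) (n : nat) : set B :=
  if (n <= 1)%N then setT else
  add_generated (\bigcup_(i in [set i | (1 <= i <= n - 1)%N])
    (star_set (G i) (G (n - i)%N) `|` addcomm_set (G i) (G (n - i)%N))).

Fixpoint Gamma_rec (fuel n : nat) : set B :=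
  if fuel is f.+1 then Gamma_step (Gamma_rec f) n else setT.

(* The recursion of depth [n] reaches all the smaller indices; [Gamma1] and    *)
(* [GammaE] below are the defining equations.  [Gamma 0] is a junk value.      *)
Definition Gamma (n : nat) : set B := Gamma_rec n n.

Definition Ann : set B :=
  [set x | forall a,
    [/\ (x * a = a * x)%g, (a * x)%g = x + a & x + a = a + x]].

End Operations.
Arguments Gamma_rec : clear implicits.
Arguments Gamma : clear implicits.
Arguments Ann : clear implicits.

Record ideal (B : skewBraceType) := Ideal {
  ideal_set :> set B;
  idealP : is_ideal ideal_set
}.

Section GammaTheory.
Variable B : skewBraceType.

Lemma Gamma_step_ext (G H : nat -> set B) (n : nat) :
  (forall i, (0 < i < n)%N -> G i = H i) -> Gamma_step G n = Gamma_step H n.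
Proof.
move=> GH; rewrite /Gamma_step; case: leqP => // n1; congr add_generated.
by apply: eq_bigcupr => i /= /andP[i0 iN]; rewrite !GH//; lia.
Qed.

Lemma Gamma_recE (f n : nat) : (n <= f)%N -> Gamma_rec B f n = Gamma B n.
Proof.
rewrite /Gamma.
elim/ltn_ind: n f => n IH [|f] nf; first by move: nf; rewrite leqn0 => /eqP->.
case: n IH nf => [|n] IH nf //=.
by apply: Gamma_step_ext => i /andP[i0 iN]; rewrite !IH//; lia.
Qed.

Lemma Gamma1 : Gamma B 1 = setT.
Proof. by []. Qed.

Lemma GammaE (n : nat) : (2 <= n)%N -> Gamma B n =
  add_generated (\bigcup_(i in [set i | (1 <= i <= n - 1)%N])
    (star_set (Gamma B i) (Gamma B (n - i)%N) `|`
     addcomm_set (Gamma B i) (Gamma B (n - i)%N))).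
Proof.
move=> n2; transitivity (Gamma_step (Gamma B) n); last first.
  by rewrite /Gamma_step leqNgt n2.
rewrite {1}/Gamma; case: n n2 => // n n2 /=.
by apply: Gamma_step_ext => i /andP[_ iN]; rewrite Gamma_recE.
Qed.

End GammaTheory.

Section BraceTheory.
Variable B : skewBraceType.
Implicit Types a b c x y : B.

Lemma braddKN a b : - a + (a + b) = b.
Proof. by rewrite braddA braddN bradd0. Qed.

Lemma braddI a b c : a + b = a + c -> b = c.
Proof. by move=> /(congr1 (+%R (- a))); rewrite !braddKN. Qed.

Lemma bradd0r a : a + 0 = a.
Proof. by apply: (@braddI (- a)); rewrite braddA braddN bradd0. Qed.

Lemma braddNr a : a - a = 0.
Proof. by apply: (@braddI (- a)); rewrite braddKN bradd0r. Qed.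

Lemma broppK a : - - a = a.
Proof. by apply: (@braddI (- a)); rewrite braddNr braddN. Qed.

Lemma braddNK a b : a + (- a + b) = b.
Proof. by rewrite braddA braddNr bradd0. Qed.

Lemma broppD a b : - (a + b) = - b - a.
Proof.
by apply: (@braddI (a + b)); rewrite braddNr -braddA braddNK braddNr.
Qed.

Lemma bropp0 : - 0 = 0 :> B.
Proof. by rewrite -[LHS]bradd0 braddNr. Qed.

Lemma brace1 : 1%g = 0 :> B.
Proof.
have := brace_eq 1%g 0 0 :> (_ = _ :> B).
rewrite bradd0 !mul1g bradd0 bradd0r => /(congr1 bropp).
by rewrite broppK bropp0.
Qed.

Lemma brmul0 a : (a * 0)%g = a.
Proof. by rewrite -brace1 mulg1. Qed.

Lemma brmulN a b : (a * - b)%g = a - (a * b)%g + a.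
Proof.
have := brace_eq a b (- b); rewrite braddNr brmul0 -!braddA.
by move=> /(congr1 (fun c => a + (- (a * b)%g + c)%R)); rewrite braddKN braddNK.
Qed.

Lemma mul_lambda a b : (a * b)%g = a + lambda a b.
Proof. by rewrite /lambda braddNK. Qed.

Lemma lambdaM a b c : lambda (a * b)%g c = lambda a (lambda b c).
Proof.
rewrite /lambda brace_eq brmulN mulgA -!braddA.
by rewrite braddKN (braddA a) braddNr bradd0.
Qed.

End BraceTheory.

Section Quotient.
Variables (B : skewBraceType) (I : ideal B).
Implicit Types a b x y : B.

Definition ideal_rel : rel B := fun x y => `[< ideal_set I (- x + y) >].

Lemma ideal_relE x y : ideal_rel x y = `[< ideal_set I (x^-1 * y)%g >].
Proof.
have [_ _ Il] := idealP I.
have E u v : - u + v = lambda u (u^-1 * v)%g by rewrite /lambda mulVKg.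
apply: asbool_equiv_eq; split=> [/(Il x^-1%g)|/(Il x)]; last by rewrite -E.
by rewrite E -lambdaM mulVg /lambda mul1g brace1 bropp0 bradd0.
Qed.

Lemma ideal_rel_equiv : equiv_class_of ideal_rel.
Proof.
have [[[I0 ID IN] _] _ _] := idealP I.
split=> [x|x y|y x z].
- by apply/asboolP; rewrite braddN.
- by apply/asboolP/asboolP => /IN; rewrite broppD broppK.
- move=> /asboolP xy /asboolP yz; apply/asboolP.
  by have := ID _ _ xy yz; rewrite -braddA braddNK.
Qed.

Canonical ideal_equiv := EquivRelPack ideal_rel_equiv.
Canonical ideal_encModRel := defaultEncModRel ideal_equiv.

(* The quotient brace B/I: the additive cosets x + I, which by [ideal_relE]    *)
(* are also the multiplicative cosets x o I.                                   *)
Definition quotient := {eq_quot ideal_equiv}%qT.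
HB.instance Definition _ := Choice.on quotient.

Definition qclass (x : B) : quotient := (\pi x)%qT.
Definition qrepr (u : quotient) : B := repr (u : {eq_quot ideal_equiv}%qT).

Lemma qreprK : cancel qrepr qclass.
Proof. exact: reprK. Qed.

Lemma qclassP x y : qclass x = qclass y <-> ideal_set I (- x + y).
Proof.
split=> [/eqmodP/asboolP//|xy].
by apply/eqmodP/asboolP.
Qed.

Lemma qclassMP x y : qclass x = qclass y <-> ideal_set I (x^-1 * y)%g.
Proof.
apply: iff_trans (qclassP x y) _.
by apply: asbool_eq_equiv; rewrite -ideal_relE.
Qed.

Definition qadd (u v : quotient) : quotient := qclass (qrepr u + qrepr v).
Definition qopp (u : quotient) : quotient := qclass (- qrepr u).
Definition qmul (u v : quotient) : quotient := qclass (qrepr u * qrepr v)%g.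
Definition qinv (u : quotient) : quotient := qclass (qrepr u)^-1%g.

Lemma qaddE x y : qadd (qclass x) (qclass y) = qclass (x + y).
Proof.
have [[[I0 ID IN] IJ] _ _] := idealP I.
have /qclassP := qreprK (qclass x); have /qclassP := qreprK (qclass y).
rewrite /qadd; move: (qrepr _) (qrepr _) => x' y' yy xx; apply/qclassP.
have /(ID _ _) /(_ yy) := IJ (- y') _ xx.
by rewrite broppD broppK -!braddA braddNK.
Qed.

Lemma qoppE x : qopp (qclass x) = qclass (- x).
Proof.
have [[[I0 ID IN] IJ] _ _] := idealP I.
have /qclassP := qreprK (qclass x).
rewrite /qopp; move: (qrepr _) => x' /IN/(IJ x'); rewrite broppD broppK => xx.
by apply/qclassP; move: xx; rewrite -!braddA braddNr bradd0r broppK.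
Qed.

Lemma qmulE x y : qmul (qclass x) (qclass y) = qclass (x * y)%g.
Proof.
have [_ [[I1 IM IV] IJ] _] := idealP I.
have /qclassMP := qreprK (qclass x); have /qclassMP := qreprK (qclass y).
rewrite /qmul; move: (qrepr _) (qrepr _) => x' y' yy xx; apply/qclassMP.
have /(IM _ _) /(_ yy) := IJ (y'^-1)%g _ xx.
by rewrite invgM invgK -!mulgA mulVKg.
Qed.

Lemma qinvE x : qinv (qclass x) = qclass x^-1%g.
Proof.
have [_ [[I1 IM IV] IJ] _] := idealP I.
have /qclassMP := qreprK (qclass x).
rewrite /qinv; move: (qrepr _) => x' /IV/(IJ x'); rewrite invgM invgK => xx.
by apply/qclassMP; move: xx; rewrite -!mulgA mulgV mulg1 invgK.
Qed.

Fact qmulA : associative qmul.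
Proof.
move=> u v w; rewrite -(qreprK u) -(qreprK v) -(qreprK w).
by rewrite !qmulE mulgA.
Qed.

Fact qmul1 : left_id (qclass 1%g) qmul.
Proof. by move=> u; rewrite -(qreprK u) qmulE mul1g. Qed.

Fact qmul1r : right_id (qclass 1%g) qmul.
Proof. by move=> u; rewrite -(qreprK u) qmulE mulg1. Qed.

Fact qmulV : left_inverse (qclass 1%g) qinv qmul.
Proof. by move=> u; rewrite -(qreprK u) qinvE qmulE mulVg. Qed.

Fact qmulVr : right_inverse (qclass 1%g) qinv qmul.
Proof. by move=> u; rewrite -(qreprK u) qinvE qmulE mulgV. Qed.

Fact qaddA : associative qadd.
Proof.
move=> u v w; rewrite -(qreprK u) -(qreprK v) -(qreprK w).
by rewrite !qaddE braddA.
Qed.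

Fact qadd0 : left_id (qclass 0) qadd.
Proof. by move=> u; rewrite -(qreprK u) qaddE bradd0. Qed.

Fact qaddN : left_inverse (qclass 0) qopp qadd.
Proof. by move=> u; rewrite -(qreprK u) qoppE qaddE braddN. Qed.

Fact qbrace u v w :
  qmul u (qadd v w) = qadd (qadd (qmul u v) (qopp u)) (qmul u w).
Proof.
rewrite -(qreprK u) -(qreprK v) -(qreprK w).
by rewrite qoppE !(qaddE, qmulE) brace_eq.
Qed.

HB.instance Definition _ :=
  isGroup.Build quotient qmulA qmul1 qmul1r qmulV qmulVr.
HB.instance Definition _ := GRing.hasAdd.Build quotient qadd.
HB.instance Definition _ := GRing.hasZero.Build quotient (qclass 0).

HB.instance Definition _ :=
  isSkewBrace.Build quotient qaddA qadd0 qaddN qbrace.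

End Quotient.

Definition annihilator_series (B : skewBraceType) (n : nat)
    (I : nat -> ideal B) :=
  [/\ ideal_set (I 0%N) = [set 0], ideal_set (I n) = setT
    & forall j, (j < n)%N ->
      ideal_set (I j) `<=` ideal_set (I j.+1) /\
      [set qclass (I j) x | x in ideal_set (I j.+1)] `<=` Ann (quotient (I j))].

Definition annihilator_nilpotent (B : skewBraceType) :=
  exists (n : nat) (I : nat -> ideal B), annihilator_series n I.

(* Main.v *)
(** If [I_0 <= ... <= I_n] is an annihilator series then [x * a], [a * x] and
    [[x, a]_+] lie in [I_j] as soon as [x] lies in [I_(j+1)].  A generator of
    [Gamma_[m]] with [m >= 2 ^ k.+1] has an entry in some [Gamma_[i]] with
    [i >= 2 ^ k], so by induction [Gamma_[m] <= I_(n-k)] whenever [m >= 2 ^ k],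
    and [Gamma_[2 ^ n]] vanishes.  Conversely the [Gamma_[m]] form a decreasing
    chain of ideals, and [Gamma_[m] / Gamma_[m+1]] is annihilated because the
    star products and commutators of [Gamma_[m]] with [B = Gamma_[1]] lie in
    [Gamma_[m+1]]. *)

Require Import Defs.
From HB Require Import structures.
From mathcomp Require Import all_boot ssralg.
From mathcomp Require Import zify.
From mathcomp Require Import boolp classical_sets.

Set Implicit Arguments.
Unset Strict Implicit.
Unset Printing Implicit Defensive.

Local Open Scope classical_set_scope.
Local Open Scope ring_scope.

Local Notation "- a" := (bropp a) : ring_scope.
Local Notation "a - b" := (a + bropp b) : ring_scope.

Section SkewBraceFacts.
Variable B : skewBraceType.
Implicit Types (a b x y : B) (X Y I : set B).

Lemma braddNrK a b : a + b - b = a.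
Proof. by rewrite -braddA braddNr bradd0r. Qed.

Lemma brsubrK a b : a - b + b = a.
Proof. by rewrite -braddA braddN bradd0r. Qed.

Lemma lambda_star a x : lambda a x = star a x + x.
Proof. by rewrite /star brsubrK. Qed.

Lemma mul_star a x : (a * x)%g = a + star a x + x.
Proof. by rewrite mul_lambda lambda_star braddA. Qed.

Lemma addcommE x y : x + y = addcomm x y + y + x.
Proof. by rewrite /addcomm !brsubrK. Qed.

Lemma opp_addcomm x y : - addcomm x y = addcomm y x.
Proof. by rewrite /addcomm !broppD !broppK !braddA. Qed.

Lemma star_eq0 a x : star a x = 0 <-> (a * x)%g = a + x.
Proof.
split=> [E|E]; first by rewrite mul_star E bradd0r.
by rewrite /star E braddKN braddNr.
Qed.

Lemma addcomm_eq0 x y : addcomm x y = 0 <-> x + y = y + x.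
Proof.
split=> [E|E]; first by rewrite addcommE E bradd0.
by rewrite /addcomm E braddNrK braddNr.
Qed.

(** [star] measures the failure of [a * x] to equal [a + x], and [addcomm] the failure of additive
    commutation. In this form the annihilator condition can be pulled back along a quotient map. *)
Lemma AnnE x : Ann B x <->
  forall a, [/\ star x a = 0, star a x = 0 & addcomm x a = 0].
Proof.
split=> Hx a; have [H1 H2 H3] := Hx a.
  by split; [apply/star_eq0; rewrite H1 H2 | apply/star_eq0; rewrite H2
            | exact/addcomm_eq0].
move: H1 H2 H3 => /star_eq0 H1 /star_eq0 H2 /addcomm_eq0 H3.
by split=> //; rewrite ?H1 H2 H3.
Qed.

Lemma add_generated_subgroup X : add_subgroup (add_generated X).
Proof.
split=> [S [[S0 _ _] _]//|x y Sx Sy S HS|x Sx S HS].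
  by case: (HS) => -[_ SD _] _; apply: SD; [exact: Sx|exact: Sy].
by case: (HS) => -[_ _ SN] _; apply: SN; exact: Sx.
Qed.

Lemma sub_add_generated X : X `<=` add_generated X.
Proof. by move=> x Xx S [_]; exact. Qed.

Lemma add_generated_min X Y :
  add_subgroup Y -> X `<=` Y -> add_generated X `<=` Y.
Proof. by move=> Ys XY x; exact. Qed.

(** Additive conjugation by [a] and [lambda a] move [x] only by left summands [addcomm a x] and
    [star a x], which lie in [I]. The products [star x a] give multiplicative normality. *)
Lemma is_idealP I : add_subgroup I ->
    (forall a x, I x -> [/\ I (star x a), I (star a x) & I (addcomm a x)]) ->
  is_ideal I.
Proof.
move=> Isub Iabs; have [I0 ID IN] := Isub.
have IJ a x : I x -> I (a + x - a).
  move=> Ix; have [_ _ Ic] := Iabs a x Ix.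
  by rewrite (addcommE a x) braddNrK; exact: ID.
have IL a x : I x -> I (lambda a x).
  by move=> Ix; rewrite lambda_star; apply: ID => //; case: (Iabs a x Ix).
split=> //; split; first split=> [|x y Ix Iy|x Ix].
- by rewrite brace1.
- by rewrite mul_lambda; apply: ID => //; exact: IL.
- suff -> : x^-1%g = - lambda x^-1%g x by exact/IN/IL.
  by rewrite /lambda mulVg brace1 bradd0r broppK.
- move=> a x Ix.
  (* With [u = x + star x a^-1] one has [x * a^-1 = u + a^-1], and the brace identity gives
     [a * (u + a^-1) = a * u - a]. *)
  have -> : (a * x * a^-1)%g = a + lambda a (x + star x a^-1%g) - a.
    rewrite -mul_lambda -mulgA (mul_star x) brace_eq mulgV brace1.
    by rewrite bradd0r.
  by apply/IJ/IL/ID => //; case: (Iabs a^-1%g x Ix).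
Qed.

End SkewBraceFacts.

Section QuotientFacts.
Variables (B : skewBraceType) (I : ideal B).
Implicit Types a x : B.

Lemma qclass_star a x :
  star (qclass I a) (qclass I x) = qclass I (star a x).
Proof.
(* The brace operations of the quotient unfold to [qadd], [qopp] and [qmul], whose values on classes
   are known. *)
rewrite [LHS](_ : _ = qadd (qadd (qopp (qclass I a))
  (qmul (qclass I a) (qclass I x))) (qopp (qclass I x)))//.
by rewrite !(qoppE, qmulE, qaddE).
Qed.

Lemma qclass_addcomm a x :
  addcomm (qclass I a) (qclass I x) = qclass I (addcomm a x).
Proof.
rewrite [LHS](_ : _ = qadd (qadd (qadd (qclass I a) (qclass I x))
  (qopp (qclass I a))) (qopp (qclass I x)))//.
by rewrite !(qoppE, qaddE).
Qed.

Lemma qclass_eq0 x : qclass I x = 0 <-> ideal_set I x.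
Proof.
have -> : (0 : quotient I) = qclass I 0 by [].
by split=> [/esym/qclassP|Ix]; last (apply/esym/qclassP);
  rewrite bropp0 bradd0.
Qed.

(** Turns each step of an annihilator series into an absorption property inside [B]. *)
Lemma Ann_qclass x : Ann (quotient I) (qclass I x) <->
  forall a, [/\ ideal_set I (star x a), ideal_set I (star a x)
              & ideal_set I (addcomm x a)].
Proof.
rewrite AnnE; split=> Hx a.
  have := Hx (qclass I a); rewrite !qclass_star qclass_addcomm.
  by case=> /qclass_eq0 ? /qclass_eq0 ? /qclass_eq0.
rewrite -(qreprK a) !qclass_star qclass_addcomm.
by have [? ? ?] := Hx (qrepr a); split; apply/qclass_eq0.
Qed.

End QuotientFacts.

Section GammaFacts.
Variable B : skewBraceType.
Implicit Types (a x y : B) (S : set B).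

Lemma Gamma_subgroup n : add_subgroup (Gamma B n).
Proof.
case: n => [|[|n]]; [by split|by split|rewrite GammaE//].
exact: add_generated_subgroup.
Qed.

Lemma Gamma_prod i j x y : (0 < i)%N -> (0 < j)%N ->
    Gamma B i x -> Gamma B j y ->
  Gamma B (i + j) (star x y) /\ Gamma B (i + j) (addcomm x y).
Proof.
move=> i0 j0 xi yj; rewrite GammaE; last by lia.
have ij : (1 <= i <= i + j - 1)%N by lia.
split; apply: sub_add_generated; exists i => //; rewrite addKn; [left|right];
  by apply: sub_add_generated; exists x => //; exists y.
Qed.

Lemma Gamma_min n S : (2 <= n)%N -> add_subgroup S ->
    (forall i j x y, (0 < i)%N -> (0 < j)%N -> (i + j)%N = n ->
       Gamma B i x -> Gamma B j y -> S (star x y) /\ S (addcomm x y)) ->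
  Gamma B n `<=` S.
Proof.
move=> n2 Ssub H; rewrite GammaE//; apply: add_generated_min => //.
move=> z [i /= /andP[i0 iN]].
have j0 : (0 < n - i)%N by lia.
have ij : (i + (n - i))%N = n by lia.
by case; apply: add_generated_min => // _ [x xi [y yj <-]];
  case: (H i (n - i)%N x y).
Qed.

(** In a generator of weight [i + j >= 3] one of the indices exceeds 1; by induction it can be
    lowered by one, which leaves a generator of weight one less. *)
Lemma Gamma_decr n : Gamma B n.+1 `<=` Gamma B n.
Proof.
elim/ltn_ind: n => -[|[|n]] IH; [by []|by []|].
apply: Gamma_min => //; first exact: Gamma_subgroup.
move=> [//|[|i]] j x y _ j0 ij xi yj.
  case: j => // j in j0 ij yj *; rewrite (_ : n.+2 = 1 + j)%N; last by lia.
  by apply: Gamma_prod => //; [lia|apply: IH => //; lia].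
rewrite (_ : n.+2 = i.+1 + j)%N; last by lia.
by apply: Gamma_prod => //; apply: IH => //; lia.
Qed.

Lemma Gamma_succ n a x : (0 < n)%N -> Gamma B n x ->
  [/\ Gamma B n.+1 (star x a), Gamma B n.+1 (star a x)
    & Gamma B n.+1 (addcomm x a)].
Proof.
move=> n0 xn.
(* Here [I] is the proof of [True], witnessing that [a] lies in [Gamma B 1], the whole brace. *)
have [] := @Gamma_prod n 1 x a n0 isT xn I; rewrite addn1 => ? ?.
by have [] := @Gamma_prod 1 n a x isT n0 I xn; rewrite add1n.
Qed.

Lemma Gamma_ideal n : is_ideal (Gamma B n).
Proof.
apply: is_idealP => [|a x xn]; first exact: Gamma_subgroup.
case: n => // n in xn *; have [? ? /Gamma_decr c] := Gamma_succ a (ltn0Sn n) xn.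
have [_ _ GN] := Gamma_subgroup n.+1.
by split; [exact: Gamma_decr|exact: Gamma_decr|rewrite -opp_addcomm; exact: GN].
Qed.

Lemma Gamma_sub_annihilator_series n (I : nat -> ideal B) k m :
    annihilator_series n I -> (k <= n)%N -> (2 ^ k <= m)%N ->
  Gamma B m `<=` ideal_set (I (n - k)%N).
Proof.
case=> _ In Iann; elim: k m => [|k IH] m kn km; first by rewrite subn0 In.
have [[Isub _] _ _] := idealP (I (n - k.+1)%N); have [_ _ IN] := Isub.
have [_ sAnn] := Iann (n - k.+1)%N ltac:(lia).
have absorb x a : ideal_set (I (n - k)%N) x ->
    [/\ ideal_set (I (n - k.+1)%N) (star x a),
        ideal_set (I (n - k.+1)%N) (star a x)
      & ideal_set (I (n - k.+1)%N) (addcomm x a)].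
  rewrite (_ : n - k = (n - k.+1).+1)%N; last by lia.
  by move=> Ix; apply: (Ann_qclass _ x).1; apply: sAnn; exists x.
have k2 : (0 < 2 ^ k)%N by rewrite expn_gt0.
rewrite expnS in km.
apply: Gamma_min => // [|i j x y i0 j0 ij xi yj]; first by lia.
have [ki|ik] := leqP (2 ^ k) i.
  by have [] := absorb x y (IH i (ltnW kn) ki x xi).
(* Now [j >= 2 ^ k], so [y] is the absorbed entry; its commutator comes out reversed, that is,
   negated. *)
have [|_ ? /IN] := absorb y x; last by rewrite opp_addcomm.
by apply: (IH j (ltnW kn) _ y yj); lia.
Qed.

End GammaFacts.

Theorem theorem2p18 (B : skewBraceType) :
  annihilator_nilpotent B <->
  exists c : nat, (0 < c)%N /\ Gamma B c = [set (0 : B)].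
Proof.
split=> [[n [I Iser]]|[c [c0 Gc]]].
  exists (2 ^ n)%N; split; first by rewrite expn_gt0.
  apply/seteqP; split=> [|_ ->]; last by case: (Gamma_subgroup B (2 ^ n)).
  have := Gamma_sub_annihilator_series Iser (leqnn n) (leqnn _).
  by rewrite subnn; case: Iser => ->.
(* The length is [c - 1] because the reversed chain starts at [Gamma B c] and reaches [Gamma B 1],
   the whole brace, at [j = c - 1]. *)
exists c.-1, (fun j => Ideal (Gamma_ideal B (c - j))); split=> /=.
- by rewrite subn0.
- by rewrite (_ : c - c.-1 = 1)%N//; lia.
move=> j jc; have cj : (c - j = (c - j.+1).+1)%N by lia.
split=> [|_ [x xG <-]]; first by rewrite cj; exact: Gamma_decr.
by apply/Ann_qclass => a /=; rewrite cj; apply: Gamma_succ => //; lia.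
Qed.
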